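(* Let $X$ be a deeply lci curve, $L$ a line bundle on $X$, $W\subset H^0(X,L)$ a linear subspace of dimension $m$, and $E$ a vector bundle on $X$. For each irreducible component $Z$ of $X$ let $m_Z$ be the dimension of the image $W_Z$ of $W$ in $H^0(Z,L\otimes\mathcal O_Z)$ and let $e_Z$ be the rank of the restriction map $H^0(X,E)\to H^0(Z,E\otimes\mathcal O_Z)$. Then for every integer $t$ with $$t\ge \max_Z\,(e_Z-m_Z+m),$$ the maximum being over all irreducible components $Z$ of $X$, the Koszul cohomology vanishes: $$\mathcal K_{t,0}(X,E,L,W)=0 .$$
   Context: All varieties are complex projective, reduced, pure-dimensional and possibly reducible; a curve is such a variety of dimension 1. A component sum $Z\le X$ is a union of irreducible components of $X$ with reduced structure; its complement is $Z^+:=\overline{X\setminus Z}$. $X$ is called deeply lci if every component sum $Z$ of $X$ is a local complete intersection and, for every component sum $Z$, the scheme-theoretic intersection $Z\cap Z^+$ is a Cartier divisor on $Z$. Koszul cohomology: $\mathcal K_{t,0}(X,E,L,W)$ is the cohomology at the middle term of the Koszul complex $$\bigwedge^{t+1}W\otimes H^0(E\otimes L^{-1})\to\bigwedge^{t}W\otimes H^0(E)\to\bigwedge^{t-1}W\otimes H^0(E\otimes L).$$ *)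

(* Defs.v *)
From HB Require Import structures.
From mathcomp Require Import all_boot all_order all_algebra.
From mathcomp Require Import fraction mpoly complex.
From mathcomp Require Import boolp classical_sets functions reals.

Set Implicit Arguments.
Unset Strict Implicit.
Unset Printing Implicit Defensive.

Import Order.TTheory GRing.Theory Num.Theory.
Local Open Scope ring_scope.
Local Open Scope classical_set_scope.

#[local] Obligation Tactic := idtac.

(* Reduced projective varieties over an algebraically closed field K are      *)
(* represented classically, as Zariski closed sets of closed points of a      *)
(* projective space, with their reduced structure.                            *)

Section ProjectiveSpace.
Variables (K : closedFieldType) (n : nat).

(* The lines through the origin of K^(n+1). *)
Definition proj := {U : {vspace 'rV[K]_n.+1} | \dim U == 1}.

(* Evaluation at an arbitrary nonzero vector of the line p.  It is only used  *)
(* through notions that do not depend on this choice: vanishing of a          *)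
(* homogeneous polynomial, and quotients of two homogeneous polynomials of    *)
(* the same degree.                                                           *)
Definition peval (a : {mpoly K[n.+1]}) (p : proj) : K :=
  a.@[fun i => vpick (val p) 0 i].

Definition zclosed (A : set proj) : Prop :=
  exists2 S : set {mpoly K[n.+1]},
    (forall a, S a -> exists d : nat, a \is d.-homog) &
    A = [set p | forall a, S a -> peval a p = 0].

Definition zopen (U : set proj) : Prop := zclosed (~` U).

Definition zclosure (A : set proj) : set proj :=
  \bigcap_(F in [set F | zclosed F /\ A `<=` F]) F.

Definition irreducible_set (A : set proj) : Prop :=
  A !=set0 /\
  forall F G, zclosed F -> zclosed G -> A `<=` F `|` G -> A `<=` F \/ A `<=` G.

Definition irr_component (X Z : set proj) : Prop :=
  [/\ irreducible_set Z, Z `<=` X &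
      forall Y, irreducible_set Y -> Z `<=` Y -> Y `<=` X -> Y = Z].

(* A chain of length d of irreducible closed subsets of A. *)
Definition irr_chain (A : set proj) (d : nat) : Prop :=
  exists F : nat -> set proj,
    (forall i, (i <= d)%N ->
       [/\ zclosed (F i), irreducible_set (F i) & F i `<=` A]) /\
    (forall i, (i < d)%N -> F i `<` F i.+1).

Definition krull_dim (A : set proj) (d : nat) : Prop :=
  irr_chain A d /\ ~ irr_chain A d.+1.

Definition projective_curve (X : set proj) : Prop :=
  [/\ zclosed X, X !=set0 & forall Z, irr_component X Z -> krull_dim Z 1].

Definition component_sum (X Z : set proj) : Prop :=
  exists2 S : set (set proj), S `<=` irr_component X & Z = \bigcup_(Y in S) Y.

End ProjectiveSpace.

(* Rings are given as subsets O of an ambient commutative ring F. *)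
Section LocalAlgebra.
Variable F : comNzRingType.
Implicit Types (O I : set F) (s : seq F).

Definition ideal_gen O s : set F :=
  [set \sum_(i < size s) c i * s`_i | c in [set c : nat -> F | range c `<=` O]].

Definition nzd_mod O I (f : F) : Prop := forall g, O g -> I (g * f) -> I g.

Definition regular_sequence O s : Prop :=
  (forall k, (k < size s)%N ->
     O s`_k /\ nzd_mod O (ideal_gen O (take k s)) s`_k) /\
  ~ ideal_gen O s 1.

End LocalAlgebra.

Section LocalCompleteIntersections.
Variables (K : closedFieldType) (n : nat).
Local Notation P := (proj K n).
Local Notation rat_fun := {fraction {mpoly K[n.+1]}}.

(* The stalk at p of the structure sheaf of projective space: the fractions   *)
(* a/b of homogeneous polynomials of the same degree, with b(p) nonzero.      *)
Definition local_ring (p : P) : set rat_fun :=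
  [set u | exists (d : nat) (a b : {mpoly K[n.+1]}),
     [/\ a \is d.-homog, b \is d.-homog, peval b p != 0 &
         u = tofrac a / tofrac b]].

(* The stalk at p of the ideal sheaf of the closed set Z with its reduced     *)
(* structure.                                                                 *)
Definition local_ideal (Z : set P) (p : P) : set rat_fun :=
  [set u | exists (d : nat) (a b : {mpoly K[n.+1]}),
     [/\ a \is d.-homog, b \is d.-homog, peval b p != 0,
         forall q, Z q -> peval a q = 0 & u = tofrac a / tofrac b]].

(* O_{Z,p} is the quotient of the regular local ring of projective space at p *)
(* by a regular sequence.                                                     *)
Definition lci (Z : set P) : Prop := forall p, Z p ->
  exists2 s : seq rat_fun, regular_sequence (local_ring p) s &
    local_ideal Z p = ideal_gen (local_ring p) s.

(* The scheme-theoretic intersection of Z and Y (whose ideal is the sum of    *)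
(* the two ideals) is an effective Cartier divisor on Z: at every p in Z, its *)
(* ideal in O_{Z,p} = local_ring p / local_ideal Z p is generated by the      *)
(* class of one element f, which is not a zero divisor.                       *)
Definition inter_cartier (Z Y : set P) : Prop := forall p, Z p ->
  exists f : rat_fun,
    [/\ local_ring p f, nzd_mod (local_ring p) (local_ideal Z p) f &
        [set u + v | u in local_ideal Z p & v in local_ideal Y p] =
        [set u + v | u in local_ideal Z p
                   & v in ideal_gen (local_ring p) [:: f]]].

Definition deeply_lci (X : set P) : Prop := forall Z, component_sum X Z ->
  lci Z /\ inter_cartier Z (zclosure (X `\` Z)).

End LocalCompleteIntersections.

Section RegularFunctions.
Variables (K : closedFieldType) (n : nat).
Local Notation P := (proj K n).

(* f is regular on the open subset (X `&` U) of X; the values of f outside U  *)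
(* are irrelevant.                                                            *)
Definition regular_on (X U : set P) (f : X -> K) : Prop :=
  forall x : X, U (val x) ->
  exists (V : set P) (d : nat) (a b : {mpoly K[n.+1]}),
    [/\ zopen V, V (val x), a \is d.-homog, b \is d.-homog &
        forall y : X, U (val y) -> V (val y) ->
          peval b (val y) != 0 /\ f y = peval a (val y) / peval b (val y)].

Lemma zopenI (U V : set P) : zopen U -> zopen V -> zopen (U `&` V).
Proof.
move=> [S hS eS] [T hT eT].
exists [set a * b | a in S & b in T].
  move=> _ [a /hS[d ad] [b /hT[e be] <-]].
  by exists (d + e)%N; apply: dhomogM.
rewrite setCI eS eT; apply/seteqP; split => p /=.
  case=> h _ [a Sa [b Tb <-]]; rewrite /peval mevalM.
    by have := h _ Sa; rewrite /peval => ->; rewrite mul0r.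
  by have := h _ Tb; rewrite /peval => ->; rewrite mulr0.
move=> h; apply: contrapT => /not_orP[/existsNP[a /not_implyP[Sa na]]].
move=> /existsNP[b /not_implyP[Tb nb]].
have /(h _) : [set a * b | a in S & b in T] (a * b) by exists a => //; exists b.
by rewrite /peval mevalM => /eqP; rewrite mulf_eq0 => /orP[] /eqP.
Qed.

Lemma zopenT : zopen (@setT P).
Proof.
exists [set 1].
  by move=> _ ->; exists 0%N; apply: dhomog1; exact: mdeg0.
rewrite setCT; apply/seteqP; split => p //= /(_ 1 erefl) /eqP.
by rewrite /peval meval1 oner_eq0.
Qed.

Lemma regular_onM (X U U' : set P) (f g : X -> K) :
  regular_on U f -> regular_on U' g -> regular_on (U `&` U') (fun x => f x * g x).
Proof.
move=> rf rg x [Ux U'x].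
have [V [d [a [b [oV Vx ha hb e]]]]] := rf x Ux.
have [V' [d' [a' [b' [oV' V'x ha' hb' e']]]]] := rg x U'x.
exists (V `&` V'), (d + d')%N, (a * a'), (b * b'); split => //.
- exact: zopenI.
- exact: dhomogM.
- exact: dhomogM.
move=> y [Uy U'y] [Vy V'y].
have [nb ->] := e y Uy Vy; have [nb' ->] := e' y U'y V'y.
move: nb nb'; rewrite /peval !mevalM => nb nb'.
by rewrite mulf_neq0 // mulf_div.
Qed.

Lemma regular_onD (X U : set P) (f g : X -> K) :
  regular_on U f -> regular_on U g -> regular_on U (fun x => f x + g x).
Proof.
move=> rf rg x Ux.
have [V [d [a [b [oV Vx ha hb e]]]]] := rf x Ux.
have [V' [d' [a' [b' [oV' V'x ha' hb' e']]]]] := rg x Ux.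
exists (V `&` V'), (d + d')%N, (a * b' + a' * b), (b * b'); split => //.
- exact: zopenI.
- by apply: dhomogD; [exact: dhomogM | rewrite addnC; exact: dhomogM].
- exact: dhomogM.
move=> y Uy [Vy V'y].
have [nb ->] := e y Uy Vy; have [nb' ->] := e' y Uy V'y.
move: nb nb'; rewrite /peval !(mevalD, mevalM) => nb nb'.
by rewrite mulf_neq0 // addf_div.
Qed.

Lemma regular_on_eq (X U : set P) (f g : X -> K) :
  (forall x : X, U (val x) -> f x = g x) -> regular_on U f -> regular_on U g.
Proof.
move=> fg rf x Ux; have [V [d [a [b [oV Vx ha hb e]]]]] := rf x Ux.
exists V, d, a, b; split => // y Uy Vy.
by have [? <-] := e y Uy Vy; rewrite fg.
Qed.

Lemma regular_onS (X U U' : set P) (f : X -> K) :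
  U' `<=` U -> regular_on U f -> regular_on U' f.
Proof.
move=> s rf x Ux; have [V [d [a [b [oV Vx ha hb e]]]]] := rf x (s _ Ux).
by exists V, d, a, b; split => // y Uy Vy; apply: e => //; apply: s.
Qed.

Lemma regular_on_cst (X U : set P) (c : K) : regular_on U (fun _ : X => c).
Proof.
move=> x Ux; exists setT, 0%N, c%:MP, 1; split => //.
- exact: zopenT.
- by rewrite -[c%:MP]mulr1 mul_mpolyC; apply: dhomogZ; apply: dhomog1; exact: mdeg0.
- by apply: dhomog1; exact: mdeg0.
by move=> y _ _; rewrite /peval meval1 mevalC oner_eq0 divr1.
Qed.

Lemma regular_on_sum (X U : set P) (I : finType) (A : {pred I}) (f : I -> X -> K) :
  (forall i, i \in A -> regular_on U (f i)) ->
  regular_on U (fun x => \sum_(i in A) f i x).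
Proof.
move=> rf.
apply: (@regular_on_eq _ _ (\sum_(i in A) f i)).
  by move=> x _; rewrite fct_sumE.
apply: (big_ind (fun g : X -> K => regular_on U g)) => //.
- exact: (regular_on_cst 0).
- by move=> g h; exact: regular_onD.
Qed.

Lemma regular_on_loc (X U : set P) (f : X -> K) :
  (forall x : X, U (val x) -> exists2 U', zopen U' /\ U' (val x) &
     regular_on (U' `&` U) f) -> regular_on U f.
Proof.
move=> h x Ux; have [U' [oU' U'x] rf] := h x Ux.
have [V [d [a [b [oV Vx ha hb e]]]]] := rf x (conj U'x Ux).
exists (U' `&` V), d, a, b; split => //; first exact: zopenI.
by move=> y Uy [U'y Vy]; apply: e.
Qed.

Definition incl (Z X : set P) (ZX : Z `<=` X) (z : Z) : X :=
  exist _ (val z) (mem_set (ZX _ (set_valP z))).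

Lemma regular_on_incl (Z X U : set P) (ZX : Z `<=` X) (f : X -> K) :
  regular_on U f -> regular_on U (fun z : Z => f (incl ZX z)).
Proof.
move=> rf x Ux; have [V [d [a [b [oV Vx ha hb e]]]]] := rf (incl ZX x) Ux.
by exists V, d, a, b; split => // y Uy Vy; have := e (incl ZX y) Uy Vy.
Qed.

End RegularFunctions.

(* A vector bundle on X: a family of finite dimensional vector spaces with a  *)
(* trivialization over each member of an open cover, whose transition         *)
(* functions are regular.  The rank may depend on the chart.                  *)
Record vbundle (K : closedFieldType) (n : nat) (X : set (proj K n)) := VBundle {
  fibre :> X -> vectType K;
  chart : Type;
  dom : chart -> set (proj K n);
  rk : chart -> nat;
  triv : forall (i : chart) (x : X), 'Hom(fibre x, 'rV[K]_(rk i));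
  dom_open : forall i, zopen (dom i);
  dom_cover : forall x : X, exists i, dom i (val x);
  triv_bij : forall i (x : X), dom i (val x) -> bijective (triv i x);
  triv_regular : forall i j (l : 'I_(rk i)) (k : 'I_(rk j)),
    regular_on (dom i `&` dom j)
      (fun x => triv j x ((triv i x)^-1%VF (delta_mx 0 l)) 0 k)
}.

Section Bundles.
Variables (K : closedFieldType) (n : nat).
Local Notation P := (proj K n).

Definition line_bundle (X : set P) (L : vbundle X) : Prop :=
  forall x : X, \dim {:L x} = 1%N.

Lemma bij_lfunK (V W : vectType K) (f : 'Hom(V, W)) :
  bijective f -> cancel f f^-1%VF /\ cancel f^-1%VF f.
Proof.
move=> bf; have fK : cancel f f^-1%VF.
  by apply: lker0_lfunK; apply/lker0P; exact: bij_inj.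
split=> // w; case: bf => g _ gK.
by rewrite -[w]gK fK.
Qed.

Lemma inv_lfun_eq (V W : vectType K) (f : 'Hom(V, W)) (v : V) (w : W) :
  bijective f -> f v = w -> f^-1%VF w = v.
Proof. by move=> /bij_lfunK[fK _] <-; rewrite fK. Qed.

Section Restriction.
Variables (Z X : set P) (ZX : Z `<=` X) (E : vbundle X).

Program Definition restrict : vbundle Z :=
  @VBundle K n Z (fun z => E (incl ZX z)) (chart E) (@dom _ _ _ E) (@rk _ _ _ E)
    (fun i z => triv i (incl ZX z)) (@dom_open _ _ _ E) _ _ _.
Next Obligation. by move=> z; apply: (dom_cover E (incl ZX z)). Qed.
Next Obligation. by move=> i z iz; apply: triv_bij. Qed.
Next Obligation.
move=> i j l k.
exact: (regular_on_incl ZX (triv_regular (v := E) (i := i) (j := j) l k)).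
Qed.

End Restriction.

Section Trivial.
Variable X : set P.

Let rowK (i : unit) (x : X) : 'Hom(K^o, 'rV[K]_1) :=
  linfun (fun a : K^o => (a : K) *: (const_mx 1 : 'rV[K]_1)).

Let rowKE i x (a : K^o) : rowK i x a = (a : K) *: const_mx 1.
Proof.
have lin : linear (fun a : K^o => (a : K) *: (const_mx 1 : 'rV[K]_1)).
  by move=> k u v; rewrite scalerDl -scalerA.
pose f := GRing.isLinear.Build K K^o 'rV[K]_1 _ _ lin.
pose ff : {linear K^o -> 'rV[K]_1} := HB.pack (fun a : K^o => (a : K) *: (const_mx 1 : 'rV[K]_1)) f.
exact: (lfunE ff).
Qed.

Let rowK_bij i x : bijective (rowK i x).
Proof.
exists (fun v : 'rV[K]_1 => v 0 0 : K^o) => [a|v].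
  by rewrite rowKE !mxE mulr1.
by rewrite rowKE; apply/rowP => k; rewrite !mxE mulr1 (ord1 k).
Qed.

Program Definition trivial_bundle : vbundle X :=
  @VBundle K n X (fun _ => K^o) unit (fun=> setT) (fun=> 1%N) rowK _ _ _ _.
Next Obligation. by move=> ?; exact: zopenT. Qed.
Next Obligation. by move=> x; exists tt. Qed.
Next Obligation. by move=> i x _; exact: rowK_bij. Qed.
Next Obligation.
move=> i j l k; apply: (@regular_on_eq _ _ _ _ (fun=> 1)); last exact: regular_on_cst.
move=> x _; have [_ ->] := bij_lfunK (rowK_bij j x).
by rewrite mxE !ord1.
Qed.

Lemma trivial_trivE (x : X) (a : K^o) :
  triv (v := trivial_bundle) tt x a 0 0 = a.
Proof. by rewrite [triv _ _ _]rowKE !mxE mulr1. Qed.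

End Trivial.

Section HomBundle.
Variables (X : set P) (A B : vbundle X).

Let hrk (c : chart A * chart B) := (rk c.1 * rk c.2)%N.

(* The matrix of phi in the given charts. *)
Let hmat (c : chart A * chart B) (x : X) (phi : 'Hom(A x, B x)) :
    'M[K]_(rk c.1, rk c.2) :=
  \matrix_(l < rk c.1)
     triv c.2 x (phi ((triv c.1 x)^-1%VF (delta_mx 0 l))).

Let htriv c x : 'Hom('Hom(A x, B x), 'rV[K]_(hrk c)) :=
  linfun (fun phi => mxvec (hmat c phi)).

Let htrivE c x phi : htriv c x phi = mxvec (hmat c phi).
Proof.
have lin : linear (fun phi : 'Hom(A x, B x) => mxvec (hmat c phi)).
  move=> k u v; rewrite -linearP; congr mxvec.
  by apply/row_matrixP => l; rewrite linearP /= !rowK !lfunE /= lfunE /= linearP.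
pose f := GRing.isLinear.Build K _ _ _ _ lin.
pose ff : {linear 'Hom(A x, B x) -> 'rV[K]_(hrk c)} :=
  HB.pack (fun phi : 'Hom(A x, B x) => mxvec (hmat c phi)) f.
exact: (lfunE ff).
Qed.

Let hinv c x (v : 'rV[K]_(hrk c)) : 'Hom(A x, B x) :=
  ((triv c.2 x)^-1 \o linfun (mulmxr (vec_mx v : 'M_(rk c.1, rk c.2))) \o triv c.1 x)%VF.

Let hdom (c : chart A * chart B) := dom c.1 `&` dom c.2.

Let htrivK c (x : X) : hdom c (val x) ->
  cancel (htriv c x) (@hinv c x) /\ cancel (@hinv c x) (htriv c x).
Proof.
case=> /triv_bij /bij_lfunK[aK Ka] /triv_bij /bij_lfunK[bK Kb].
split=> [phi|v].
  rewrite htrivE; apply/lfunP => u; rewrite /hinv !comp_lfunE lfunE /= mxvecK.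
  apply: (can_inj bK); rewrite Kb -{2}[u]aK [triv c.1 x u]row_sum_delta.
  rewrite mulmx_suml !linear_sum /=; apply: eq_bigr => l _.
  by rewrite -scalemxAl !linearZ /= -rowE rowK.
rewrite htrivE -[RHS]vec_mxK; congr mxvec.
by apply/row_matrixP => l; rewrite rowK /hinv !comp_lfunE lfunE /= Ka Kb -rowE.
Qed.

Let htriv_bij c (x : X) : hdom c (val x) -> bijective (htriv c x).
Proof. by move=> /htrivK[? ?]; exists (@hinv c x). Qed.

Program Definition hom_bundle : vbundle X :=
  @VBundle K n X (fun x => 'Hom(A x, B x) : vectType K) (chart A * chart B)%type
    hdom hrk htriv _ _ _ _.
Next Obligation. by move=> c; apply: zopenI; exact: dom_open. Qed.
Next Obligation.
move=> x; have [i ix] := dom_cover A x; have [j jx] := dom_cover B x.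
by exists (i, j).
Qed.
Next Obligation. exact: htriv_bij. Qed.
Next Obligation.
move=> c c' l k.
case/mxvec_indexP: l => l1 l2; case/mxvec_indexP: k => k1 k2.
pose f (x : X) := triv c.1 x ((triv c'.1 x)^-1%VF (delta_mx 0 k1)) 0 l1 *
  triv c'.2 x ((triv c.2 x)^-1%VF (delta_mx 0 l2)) 0 k2.
apply: (@regular_on_eq _ _ _ _ f).
  move=> x [cx cx'].
  have -> : (htriv c x)^-1%VF (delta_mx 0 (mxvec_index l1 l2)) =
            hinv x (delta_mx 0 (mxvec_index l1 l2)).
    by apply: inv_lfun_eq; [exact: htriv_bij | have [_ ->] := htrivK cx].
  rewrite htrivE mxvecE mxE /hinv !comp_lfunE lfunE /= vec_mx_delta /f.
  set u := triv c.1 x _.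
  have -> : u *m delta_mx l1 l2 = u 0 l1 *: delta_mx 0 l2 :> 'rV_(rk c.2).
    rewrite [in LHS](row_sum_delta u) mulmx_suml (bigD1 l1) //= big1 ?addr0.
      by rewrite -scalemxAl mul_delta_mx.
    by move=> i il; rewrite -scalemxAl mul_delta_mx_0 ?scaler0.
  by rewrite !linearZ /= mxE.
apply: regular_onS (regular_onM (triv_regular (v := A) k1 l1)
                                (triv_regular (v := B) l2 k2)).
by move=> p [[? ?] [? ?]].
Qed.

Lemma hom_rowE (c : chart A * chart B) (x : X) (phi : 'Hom(A x, B x)) (l : 'I_(rk c.1)) :
  row l (vec_mx (triv (v := hom_bundle) c x phi)) =
  triv c.2 x (phi ((triv c.1 x)^-1%VF (delta_mx 0 l))).
Proof. by rewrite [triv _ _ _]htrivE mxvecK rowK. Qed.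

Lemma hom_trivE (c : chart A * chart B) (x : X) (phi : 'Hom(A x, B x)) (u : A x) : dom (v := hom_bundle) c (val x) ->
  triv c.2 x (phi u) =
  triv c.1 x u *m vec_mx (triv (v := hom_bundle) c x phi).
Proof.
move=> cx; have [hK _] := htrivK cx.
have : @hinv c x (triv (v := hom_bundle) c x phi) = phi by exact: hK.
case: cx => _ /triv_bij /bij_lfunK[_ Kb].
move: (triv (v := hom_bundle) c x phi) => v <-.
by rewrite /hinv !comp_lfunE lfunE /= Kb.
Qed.

End HomBundle.

Definition dual_bundle (X : set P) (A : vbundle X) : vbundle X :=
  hom_bundle A (trivial_bundle X).

(* Finite dimensional vector spaces satisfy A (x) M = Hom(M^*, A). *)
Definition tensor_bundle (X : set P) (A M : vbundle X) : vbundle X :=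
  hom_bundle (dual_bundle M) A.

(* All (set-theoretic) sections. *)
Definition sec (X : set P) (E : vbundle X) := forall x : X, E x.

Section SecLmodule.
Variables (X : set P) (E : vbundle X).
Implicit Types s t : sec E.

HB.instance Definition _ := gen_eqMixin (sec E).
HB.instance Definition _ := gen_choiceMixin (sec E).

Let add s t : sec E := fun x => s x + t x.
Let opp s : sec E := fun x => - s x.
Let scale (k : K) s : sec E := fun x => k *: s x.

Let addA : associative add.
Proof. by move=> ? ? ?; apply: functional_extensionality_dep => x; exact: addrA. Qed.
Let addC : commutative add.
Proof. by move=> ? ?; apply: functional_extensionality_dep => x; exact: addrC. Qed.
Let add0 : left_id ((fun x => 0) : sec E) add.
Proof. by move=> ?; apply: functional_extensionality_dep => x; exact: add0r. Qed.
Let addN : left_inverse ((fun x => 0) : sec E) opp add.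
Proof. by move=> ?; apply: functional_extensionality_dep => x; exact: addNr. Qed.

HB.instance Definition _ := GRing.isZmodule.Build (sec E) addA addC add0 addN.

Let scaleA (a b : K) s : scale a (scale b s) = scale (a * b) s.
Proof. by apply: functional_extensionality_dep => x; exact: scalerA. Qed.
Let scale1 : left_id 1 scale.
Proof. by move=> ?; apply: functional_extensionality_dep => x; exact: scale1r. Qed.
Let scaleDr : right_distributive scale +%R.
Proof. by move=> ? ? ?; apply: functional_extensionality_dep => x; exact: scalerDr. Qed.
Let scaleDl s : {morph scale^~ s : a b / a + b}.
Proof. by move=> ? ?; apply: functional_extensionality_dep => x; exact: scalerDl. Qed.

HB.instance Definition _ :=
  GRing.Zmodule_isLmodule.Build K (sec E) scaleA scale1 scaleDr scaleDl.

End SecLmodule.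

(* The space of global (regular) sections. *)
Definition H0 (X : set P) (E : vbundle X) : set (sec E) :=
  [set s | forall (i : chart E) (k : 'I_(rk i)),
             regular_on (dom i) (fun x => triv i x (s x) 0 k)].
Arguments H0 {X} E.

Section H0Theory.
Variable X : set P.
Implicit Types (A B M : vbundle X).

Lemma H0_0 A : H0 A 0.
Proof.
move=> i k; apply: (@regular_on_eq _ _ _ _ (fun=> 0)); last exact: regular_on_cst.
by move=> x _; rewrite [(0 : sec A) x](_ : _ = 0) // linear0 mxE.
Qed.

Lemma H0_D A (s t : sec A) : H0 _ s -> H0 _ t -> H0 _ (s + t).
Proof.
move=> hs ht i k.
apply: (regular_on_eq _ (regular_onD (hs i k) (ht i k))) => x _.
by rewrite [(s + t) x](_ : _ = s x + t x) // linearD mxE.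
Qed.

Lemma H0_Z A (a : K) (s : sec A) : H0 _ s -> H0 _ (a *: s).
Proof.
move=> hs i k.
have h := regular_onM (regular_on_cst (U := dom i) a) (hs i k).
rewrite setIid in h; apply: regular_on_eq h => x _.
by rewrite [(a *: s) x](_ : _ = a *: s x) // linearZ mxE.
Qed.

Lemma H0_sum A (I : finType) (Q : {pred I}) (s : I -> sec A) :
  (forall i, i \in Q -> H0 _ (s i)) -> H0 _ (\sum_(i in Q) s i).
Proof.
by move=> hs; apply: (big_ind (H0 A)) => //; [exact: H0_0 | exact: H0_D].
Qed.

Lemma H0_app A B (s : sec (hom_bundle A B)) (u : sec A) :
  H0 _ s -> H0 _ u -> H0 _ ((fun x => (s x : 'Hom(A x, B x)) (u x)) : sec B).
Proof.
move=> hs hu i k; apply: regular_on_loc => x ix.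
have [j jx] := dom_cover A x.
exists (dom j); first by split=> //; exact: dom_open.
pose f l (y : X) := triv j y (u y) 0 l *
  triv (v := hom_bundle A B) (j, i) y (s y) 0 (mxvec_index l k).
apply: (@regular_on_eq _ _ _ _ (fun y => \sum_(l in predT) f l y)).
  move=> y cy; rewrite (@hom_trivE X A B (j, i) y (s y) (u y)) // mxE.
  by apply: eq_bigr => l _; rewrite [vec_mx _ _ _]mxE.
apply: regular_on_sum => l _.
apply: regular_onS (regular_onM (hu j l) (hs (j, i) (mxvec_index l k))).
by move=> p [jp ip]; do !split.
Qed.

End H0Theory.

Definition res (Z X : set P) (ZX : Z `<=` X) (E : vbundle X) (s : sec E) :
    sec (restrict ZX E) :=
  fun z => s (incl ZX z).

End Bundles.

Arguments H0 {K n X} E.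
Arguments res {K n Z X} ZX E s.

Section Dimension.
Variables (K : fieldType) (V : lmodType K).

(* v is a basis of A; in particular A is a linear subspace. *)
Definition is_basis (A : set V) (d : nat) (v : 'I_d -> V) : Prop :=
  (forall c : 'I_d -> K, \sum_i c i *: v i = 0 -> forall i, c i = 0) /\
  A = range (fun c : 'I_d -> K => \sum_i c i *: v i).

Definition has_dim (A : set V) (d : nat) : Prop :=
  exists v : 'I_d -> V, is_basis A v.

End Dimension.

Section Koszul.
Variables (K : closedFieldType) (n : nat) (X : set (proj K n)).

(* e (x) l, seen in Hom(M^*, A). *)
Definition tensor_mul (A M : vbundle X) (x : X) (e : A x) (l : M x) :
    tensor_bundle A M x :=
  linfun (fun lam : dual_bundle M x => (lam l : K) *: e).

(* The contraction of the factor L^-1 with L: A (x) L^-1 is Hom(L^**, A), and *)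
(* l is sent to L^** by evaluation.                                           *)
Definition tensor_contr (A L : vbundle X) (x : X)
    (t : tensor_bundle A (dual_bundle L) x) (l : L x) : A x :=
  t (linfun (fun lam : dual_bundle L x => lam l : K^o)).

Lemma linfunE (U V : vectType K) (f : U -> V) : linear f -> linfun f =1 f.
Proof.
move=> lf.
pose g := GRing.isLinear.Build K U V _ _ lf.
pose ff : {linear U -> V} := HB.pack f g.
exact: (lfunE ff).
Qed.

Lemma tensor_mulE (A M : vbundle X) (x : X) (e : A x) (l : M x)
  (lam : dual_bundle M x) :
  (tensor_mul e l : 'Hom(dual_bundle M x, A x)) lam =
  ((lam : 'Hom(M x, K^o)) l : K) *: e.
Proof.
rewrite /tensor_mul linfunE // => k u v.
by rewrite add_lfunE scale_lfunE scalerDl -scalerA.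
Qed.

Lemma evE (L : vbundle X) (x : X) (l : L x) (lam : dual_bundle L x) :
  linfun (fun lam : dual_bundle L x => (lam : 'Hom(L x, K^o)) l : K^o) lam =
  (lam : 'Hom(L x, K^o)) l.
Proof. by rewrite linfunE // => k u v; rewrite add_lfunE scale_lfunE. Qed.

Lemma dual_pairE (L : vbundle X) (x : X) (j : chart L) (l : L x) p :
  dom j (val x) ->
  triv (v := trivial_bundle X) tt x
    ((((triv (v := dual_bundle L) (j, tt) x)^-1%VF (delta_mx 0 p)) : 'Hom(L x, K^o)) l)
  = triv j x l *m vec_mx (delta_mx 0 p).
Proof.
move=> jx; set phi := (_^-1)%VF _.
rewrite (@hom_trivE _ _ _ L (trivial_bundle X) (j, tt) x phi l) //=.
rewrite /phi; have [|_ ->] // := @bij_lfunK K _ _ (triv (v := dual_bundle L) (j, tt) x).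
exact: triv_bij.
Qed.

Lemma H0_ev (L : vbundle X) (l : sec L) : H0 L l ->
  H0 (dual_bundle (dual_bundle L))
    (fun x => linfun (fun lam : dual_bundle L x => lam (l x) : K^o)).
Proof.
move=> hl [[j []] []] k; case/mxvec_indexP: k => p q.
apply: (@regular_on_eq _ _ _ _
  (fun x => (triv j x (l x) *m vec_mx (delta_mx 0 p)) 0 q)).
  move=> x [[jx _] _].
  rewrite -(dual_pairE (l x) p jx) -(evE (l x)).
  rewrite -(@hom_rowE _ _ _ (dual_bundle L) (trivial_bundle X) ((j, tt), tt) x).
  by rewrite [LHS]mxE [LHS]mxE.
apply: (@regular_on_eq _ _ _ _ (fun x => \sum_(i in predT)
  triv j x (l x) 0 i * vec_mx (delta_mx 0 p) i q)).
  by move=> x _; rewrite [RHS]mxE.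
apply: regular_on_sum => i _.
have := regular_onM (hl j i) (@regular_on_cst _ _ X (dom j) (vec_mx (delta_mx 0 p) i q)).
by apply: regular_onS => x [[]].
Qed.

Lemma H0_contr (A L : vbundle X) s (l : sec L) :
  H0 (tensor_bundle A (dual_bundle L)) s -> H0 L l ->
  H0 A (fun x => tensor_contr (s x) (l x)).
Proof. by move=> hs hl; exact: H0_app hs (H0_ev hl). Qed.

Lemma H0_mul (A L : vbundle X) (s : sec A) (l : sec L) :
  H0 A s -> H0 L l ->
  H0 (tensor_bundle A L) (fun x => tensor_mul (s x) (l x)).
Proof.
move=> hs hl [[j []] i] k; case/mxvec_indexP: k => p q.
apply: (@regular_on_eq _ _ _ _
  (fun x => (triv j x (l x) *m vec_mx (delta_mx 0 p)) 0 0 * triv i x (s x) 0 q)).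
  move=> x [[jx _] ix].
  transitivity ((row p (vec_mx (triv (v := tensor_bundle A L) (j, tt, i) x
    (tensor_mul (s x) (l x))))) 0 q); last by rewrite [LHS]mxE [LHS]mxE.
  rewrite (@hom_rowE _ _ _ (dual_bundle L) A (j, tt, i) x) tensor_mulE.
  rewrite linearZ [RHS]mxE; congr (_ * _).
  rewrite -(dual_pairE (l x) p jx).
  by rewrite trivial_trivE.
apply: regular_onS (regular_onM _ (hs i q)); first by move=> y [[jy _] iy]; split; [exact: jy|].
apply: (@regular_on_eq _ _ _ _ (fun x => \sum_(i in predT)
  triv j x (l x) 0 i * vec_mx (delta_mx 0 p) i 0)).
  by move=> x _; rewrite [RHS]mxE.
apply: regular_on_sum => r _.
have := regular_onM (hl j r) (@regular_on_cst _ _ X (dom j) (vec_mx (delta_mx 0 p) r 0)).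
by rewrite setIid.
Qed.

Variables (L : vbundle X) (m : nat) (w : 'I_m -> sec L).

(* If w is a basis of W, the exterior algebra of W has the basis              *)
(* w_A = w_{a_1} /\ ... /\ w_{a_t} indexed by the subsets A = {a_1 < ... < a_t}*)
(* of 'I_m; the family c stands for the sum over A of w_A (x) c A.            *)
Definition koszul_chain (B : vbundle X) (S : set (sec B)) (t : int) :
    set ({set 'I_m} -> sec B) :=
  [set c | forall A : {set 'I_m}, S (c A) /\ (#|A|%:Z != t -> c A = 0)].

(* The Koszul differential, sending w_A (x) s to the sum over k = 1..t of     *)
(* (-1)^(k-1) w_{A \ a_k} (x) w_{a_k} s.                                      *)
Definition koszul_d (B C : vbundle X) (mul : forall x : X, B x -> L x -> C x)
    (c : {set 'I_m} -> sec B) : {set 'I_m} -> sec C :=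
  fun A x => \sum_(i in ~: A)
    (-1) ^+ #|[set j in A | (j < i)%N]| *: mul x (c (i |: A) x) (w i x).

(* The kernel in /\^t W (x) H^0(E) of the map to /\^(t-1) W (x) H^0(E (x) L). *)
Definition koszul_cycles (E : vbundle X) (t : int) : set ({set 'I_m} -> sec E) :=
  koszul_chain (H0 E) t `&` [set c | koszul_d (@tensor_mul E L) c = 0].

(* The image of /\^(t+1) W (x) H^0(E (x) L^-1). *)
Definition koszul_boundaries (E : vbundle X) (t : int) :
    set ({set 'I_m} -> sec E) :=
  koszul_d (@tensor_contr E L) @`
    koszul_chain (H0 (tensor_bundle E (dual_bundle L))) (t + 1).

(* K_{t,0}(X, E, L, W) = 0, i.e. exactness at the middle term, where W has    *)
(* the basis w; koszul_complex below says that this is a complex.             *)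
Definition koszul_vanishing (E : vbundle X) (t : int) : Prop :=
  @koszul_cycles E t = @koszul_boundaries E t.

Let sgn (A : {set 'I_m}) (i : 'I_m) := #|[set j in A | (j < i)%N]|.

Let sgnU (A : {set 'I_m}) i j : i \notin A -> sgn (i |: A) j = ((i < j)%N + sgn A j)%N.
Proof.
move=> iA; rewrite /sgn; case ij: (i < j)%N.
  have -> : [set k in i |: A | (k < j)%N] = i |: [set k in A | (k < j)%N].
    by apply/setP => k; rewrite !inE; case: eqP => [->|//]; rewrite ij.
  by rewrite cardsU1 inE negb_and iA.
rewrite add0n; congr #|pred_of_set _|.
by apply/setP => k; rewrite !inE; case: eqP => [->|//]; rewrite ij !andbF.
Qed.

Lemma tensor_mul_contrC (A : vbundle X) (x : X)
    (t : tensor_bundle A (dual_bundle L) x) (l l' : L x) : line_bundle L ->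
  tensor_mul (tensor_contr t l) l' = tensor_mul (tensor_contr t l') l.
Proof.
move=> /(_ x) dL.
have [e he] : exists e : L x, forall u, exists k, u = k *: e.
  have [[e ne0]|nex] := pselect (exists e : L x, e != 0).
    exists e => u; apply/vlineP.
    have /eqP -> : (<[e]> == fullv)%VS by rewrite eqEdim subvf dL dim_vline ne0.
    by rewrite memvf.
  exists 0 => u; exists 0; rewrite scaler0; apply: contrapT => /eqP u0.
  by apply: nex; exists u.
have [k ->] := he l; have [k' ->] := he l'.
pose ev (u : L x) := linfun (fun lam : dual_bundle L x => lam u : K^o).
have evZ a u : ev (a *: u) = a *: ev u.
  by apply/lfunP => lam; rewrite scale_lfunE !evE linearZ.
apply/lfunP => lam; rewrite !tensor_mulE /tensor_contr -!/(ev _) !evZ.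
by rewrite !linearZ /= !scalerA; congr (_ *: _); exact: mulrCA.
Qed.

Lemma koszul_dd (A : vbundle X) c : line_bundle L ->
  koszul_d (@tensor_mul A L) (koszul_d (@tensor_contr A L) c) = 0.
Proof.
move=> hL; apply/funext => S; apply: functional_extensionality_dep => x.
rewrite [RHS](_ : _ = 0) // {1}/koszul_d.
pose F i j := tensor_mul (tensor_contr (c (j |: (i |: S)) x) (w j x)) (w i x).
have mulD i : linear (fun e : A x => tensor_mul e (w i x)).
  move=> k u v; apply/lfunP => lam.
  by rewrite add_lfunE scale_lfunE !tensor_mulE scalerDr !scalerA mulrC.
have mul_sum i (Q : {pred 'I_m}) (f : 'I_m -> A x) (k : 'I_m -> K) :
    tensor_mul (\sum_(j in Q) k j *: f j) (w i x) =
    \sum_(j in Q) k j *: tensor_mul (f j) (w i x).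
  have h := linfunE (mulD i).
  by rewrite -h linear_sum; apply: eq_bigr => j _; rewrite linearZ /= h.
pose G i j := (-1) ^+ (sgn S i + sgn S j + (i < j)%N) *: F i j.
transitivity (\sum_(i in ~: S) \sum_(j in ~: S | j != i) G i j).
  apply: eq_bigr => i; rewrite inE => iS.
  rewrite mul_sum scaler_sumr; apply: eq_big => j.
    by rewrite !inE negb_or andbC.
  move=> _; rewrite scalerA -exprD -!/(sgn _ _) sgnU //.
  by rewrite /G addnAC addnA (addnC _ (sgn S j)) addnA.
have GC i j : j != i -> G i j = - G j i.
  move=> ji; rewrite /G /F tensor_mul_contrC // finset.setUCA -scaleNr; congr (_ *: _).
  rewrite (addnC (sgn S j)) !exprD -mulrN; congr (_ * _).
  by move: ji; rewrite -val_eqE /=; case: ltngtP => //= _ _; rewrite expr0 expr1 ?opprK.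
rewrite pair_big_dep /= (bigID (fun p : 'I_m * 'I_m => (p.1 < p.2)%N)) /=.
rewrite [X in _ + X](reindex_inj (h := fun p : 'I_m * 'I_m => (p.2, p.1))) /=; last first.
  by move=> [a b] [a' b'] [-> ->].
rewrite [X in _ + X](eq_bigl (fun p : 'I_m * 'I_m =>
  ((p.1 \in ~: S) && ((p.2 \in ~: S) && (p.2 != p.1))) && (p.1 < p.2)%N)); last first.
  move=> [i j] /=; rewrite -val_eqE /= (eq_sym (val i)).
  by case: (i \in _); case: (j \in _) => //=; rewrite -val_eqE; case: ltngtP.
rewrite -big_split /= big1 // => -[i j] /= /andP[/and3P[_ _ ji] _].
by rewrite (GC i j ji) addNr.
Qed.

Lemma koszul_complex (E : vbundle X) (t : int) :
  line_bundle L -> (forall i, H0 L (w i)) ->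
  @koszul_boundaries E t `<=` @koszul_cycles E t.
Proof.
move=> hL hw _ [b hb <-]; split; last exact: koszul_dd.
move=> A; split.
  have -> : koszul_d (@tensor_contr E L) b A = \sum_(i in ~: A)
      (-1) ^+ sgn A i *: ((fun x => tensor_contr (b (i |: A) x) (w i x)) : sec E).
    apply: functional_extensionality_dep => x.
    apply: (big_rec2 (fun (u : E x) (v : sec E) => u = v x)) => // i u v _ ->.
    by [].
  apply: H0_sum => i _; apply: H0_Z; apply: H0_contr (hw i).
  by have [] := hb (i |: A).
move=> At; apply: functional_extensionality_dep => x.
rewrite [RHS](_ : _ = 0) // /koszul_d big1 // => i; rewrite inE => iA.
have [_ ->] := hb (i |: A); last first.
  by rewrite cardsU1 iA -(inj_eq (addIr (-1))) PoszD addrAC subrr add0r addrK.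
by rewrite [(0 : sec _) x](_ : _ = 0) // /tensor_contr zero_lfunE scaler0.
Qed.

End Koszul.

(* Main.v *)
Require Import Defs.
From HB Require Import structures.
From mathcomp Require Import all_boot all_order all_algebra.
From mathcomp Require Import fraction mpoly complex.
From mathcomp Require Import boolp classical_sets functions reals.
Import Order.TTheory GRing.Theory Num.Theory.
Local Open Scope ring_scope.

Set Implicit Arguments.
Unset Strict Implicit.
Unset Printing Implicit Defensive.

(** Under the bound on t, every cycle of degree t with coefficients in H^0(E) is
    zero, hence a boundary.

    An element of the t-th exterior power of W with coefficients in H^0(E) is
    a cycle exactly when, at each point x of X, its contraction with the
    evaluation functional ev_x (defined up to a scalar, L being a line bundle)
    takes values that vanish at x.  Fix an irreducible component Z and a space
    V of sections on Z, of dimension at most e; write r for the dimension of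
    the restriction of W to Z.  By induction on e, a cycle c of degree t with
    coefficients in V is zero on Z as soon as t >= e - r + m ([cycles_eq0]).
    - Let x be a point of Z at which some section of V does not vanish.  As
      contractions anticommute ([contractC]), the contraction of c with ev_x is
      again a cycle; its degree is t - 1 and its coefficients lie in the
      sections of V that vanish at x, a space of dimension at most e - 1
      ([dim_le_vanish]).  By induction this contraction is zero.
    - These points x are dense in the irreducible set Z, so that the
      functionals ev_x span the r-dimensional dual of the restriction of W to Z
      ([evaluation_rank]).
    - A form of degree t > m - r killed by an r-dimensional space of
      contractions is zero ([contract_eq0]): it belongs to the t-th exterior
      power of the subspace, of dimension m - r, annihilated by these
      contractions.

    Finally every point of X lies on an irreducible component
    ([irr_component_cover]), and a section of E is determined by its values
    because X is reduced. *)

(** * Contractions of exterior forms *)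

Section LinearCombinations.
Variables (K : fieldType) (U G : lmodType K).

Lemma linear_comb (f : U -> G) (I : finType) (Q : pred I) (a : I -> K)
    (s : I -> U) : linear f ->
  f (\sum_(i | Q i) a i *: s i) = \sum_(i | Q i) a i *: f (s i).
Proof.
move=> lf; pose g := GRing.isLinear.Build K U G _ _ lf.
pose ff : {linear U -> G} := HB.pack f g.
by rewrite -[f]/(ff : U -> G) linear_sum; apply: eq_bigr => i _; rewrite linearZ.
Qed.

Lemma comb_mulmx d p (a : 'rV[K]_d) (C : 'M[K]_(d, p)) (s : 'I_p -> U) :
  \sum_i (a *m C) 0 i *: s i = \sum_k a 0 k *: \sum_i C k i *: s i.
Proof.
under [RHS]eq_bigr do rewrite scaler_sumr.
rewrite exchange_big /=; apply: eq_bigr => i _.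
by rewrite mxE scaler_suml; apply: eq_bigr => k _; rewrite scalerA.
Qed.

Lemma lowrank_kernel d p (C : 'M[K]_(d, p)) :
  (\rank C < d)%N -> exists2 a : 'rV[K]_d, a != 0 & a *m C = 0.
Proof.
move=> rC; have /rowV0Pn[a /sub_kermxP aC a0] : kermx C != 0.
  by rewrite kermx_eq0 /row_free neq_ltn rC.
by exists a.
Qed.

End LinearCombinations.

Section Contraction.
Variables (K : fieldType) (m : nat) (U : lmodType K).
Implicit Types (u v : 'rV[K]_m) (c : {set 'I_m} -> U) (A B : {set 'I_m}).

Definition position A (i : 'I_m) := #|[set j in A | (j < i)%N]|.

Lemma positionU1 A i j :
  i \notin A -> position (i |: A) j = ((i < j)%N + position A j)%N.
Proof.
move=> iA; rewrite /position; case ij: (i < j)%N.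
  have -> : [set k in i |: A | (k < j)%N] = i |: [set k in A | (k < j)%N].
    by apply/setP => k; rewrite !inE; case: eqP => [->|//]; rewrite ij.
  by rewrite cardsU1 inE negb_and iA.
rewrite add0n; congr #|pred_of_set _|.
by apply/setP => k; rewrite !inE; case: eqP => [->|//]; rewrite ij !andbF.
Qed.

(** The interior product of the form c with the linear functional whose
    coordinates are v; its signs are those of the Koszul differential. *)
Definition contract v c A : U :=
  \sum_(i in ~: A) ((-1) ^+ position A i * v 0 i) *: c (i |: A).

Lemma contract_linear a u v c A :
  contract (a *: u + v) c A = a *: contract u c A + contract v c A.
Proof.
rewrite /contract scaler_sumr -big_split /=; apply: eq_bigr => i _.
by rewrite !mxE scalerA -scalerDl mulrDr mulrCA.
Qed.

Lemma contract_deg v c t A : (forall B, #|B| != t.+1 -> c B = 0) ->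
  #|A| != t -> contract v c A = 0.
Proof.
move=> hc At; apply: big1 => i; rewrite inE => iA.
by rewrite hc ?scaler0 // cardsU1 iA.
Qed.

(** Both sides sum, over the ordered pairs of distinct indices outside A, terms
    that agree up to a sign; exchanging the two indices flips it, as exactly one
    of i < j and j < i holds. *)
Lemma contractC u v c A :
  contract u (contract v c) A = - contract v (contract u c) A.
Proof.
pose F u v i j := ((-1) ^+ (position A i + position A j + (i < j)%N) *
   (u 0 i * v 0 j)) *: c (j |: (i |: A)).
have E u' v' : contract u' (contract v' c) A =
    \sum_i \sum_(j | [&& i \notin A, j \notin A & j != i]) F u' v' i j.
  rewrite /contract big_mkcond /=; apply: eq_bigr => i _; rewrite inE.
  case: ifPn => iA; last by rewrite big_pred0.
  rewrite scaler_sumr; apply: eq_big => j.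
    by rewrite !inE negb_or andbC.
  move=> _; rewrite scalerA positionU1 // /F; congr (_ *: _).
  by rewrite mulrACA -exprD (addnC (i < j)%N) addnA.
rewrite !E -sumrN (exchange_big_dep predT) //=; apply: eq_bigr => i _.
rewrite -sumrN; apply: eq_big => j; first by rewrite andbCA eq_sym.
case/and3P=> jA iA; rewrite -val_eqE /= => ij.
rewrite /F finset.setUCA -scaleNr -mulNr; congr (_ *: _).
rewrite (mulrC (u 0 j)) (addnC (position A j)) !exprD -mulrN; congr (_ * _ * _).
by case: ltngtP ij => //= _ _; rewrite ?opprK.
Qed.

(** Echelon form: the row space of M contains vectors which restrict to the
    standard basis on a set P of \rank M pivot coordinates.  A set A of size t is
    too large to avoid P; contracting c with the vector of a pivot a of A, at
    the index A :\ a, expresses c A through values of c at sets with one pivot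
    less. *)
Lemma contract_eq0 (M : 'M[K]_m) t c :
  (forall A, #|A| != t -> c A = 0) ->
  (forall v, (v <= M)%MS -> forall A, contract v c A = 0) ->
  (m < t + \rank M)%N -> forall A, c A = 0.
Proof.
move=> hc hM tm.
move: tm; rewrite -mxrank_tr => tm.
pose f : 'I_(\rank M^T) -> 'I_m := maxrankfun M^T; pose N0 := rowsub f M^T.
have [D BD] : exists D, N0 *m D = 1%:M.
  by apply/row_freeP; exact: maxrowsub_free.
pose N := D^T *m M.
have NE k l : N k (f l) = (l == k)%:R.
  transitivity ((N0 *m D) l k); last by rewrite BD mxE.
  by rewrite !mxE; apply: eq_bigr => a _; rewrite !mxE mulrC.
pose P := f @: 'I_(\rank M^T).
have cP : #|P| = \rank M^T.
  by rewrite card_imset; [rewrite card_ord | exact: maxrankfun_inj].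
(* Induction on the number of pivots in A. *)
move=> A; move: {2}#|A :&: P|.+1 (ltnSn #|A :&: P|) => k.
elim: k A => // k IH A Ak.
have [/eqP At|/hc //] := boolP (#|A| == t).
have [a aA /imsetP[l _ al]] : exists2 a, a \in A & a \in P.
  have : A :&: P != finset.set0.
    apply: contraTneq tm => AP0; rewrite -leqNgt -At -cP.
    by rewrite -cardsUI AP0 cards0 addn0 -[m in (_ <= m)%N]card_ord max_card.
  by case/set0Pn => a; rewrite inE => /andP[]; exists a.
have aP : a \in P by rewrite al imset_f.
(* Off the pivot a, the vector row l N is zero on P. *)
have Nl : (row l N <= M)%MS by rewrite (submx_trans (row_sub _ _)) // submxMl.
have := hM _ Nl (A :\ a); rewrite /contract (bigD1 a) /=; last by rewrite !inE eqxx.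
rewrite finset.setD1K // big1 ?addr0.
  have Nla : N l a = 1 by rewrite al NE eqxx.
  rewrite (mxE _ _ 0 a) Nla mulr1 => /eqP; rewrite scaler_eq0 signr_eq0 /=.
  by move/eqP.
move=> i; rewrite !inE negb_and negbK => /andP[iA ia].
have [iP|iP] := boolP (i \in P).
  case/imsetP: iP => l' _ il; rewrite mxE il NE.
  case: eqP => [ll|_]; last by rewrite mulr0 scale0r.
  by rewrite il al ll eqxx in ia.
rewrite IH ?scaler0 //; rewrite ltnS in Ak; apply: leq_trans Ak; apply: proper_card.
apply/properP; split.
  apply/fintype.subsetP => b; rewrite !inE => /andP[/orP[/eqP ->|/andP[_ ->]] //].
  by rewrite (negPf iP).
by exists a; rewrite !inE ?aA ?aP // eqxx (eq_sym a) (negPf ia).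
Qed.

(** The functionals that annihilate a form are given by a predicate which need
    not be decidable; a matrix of maximal rank among those whose rows satisfy
    it turns them into a row space. *)
Lemma prop_subspace_rowspace (S : 'rV[K]_m -> Prop) :
  S 0 -> (forall a u v, S u -> S v -> S (a *: u + v)) ->
  exists M : 'M[K]_m, forall v, S v <-> (v <= M)%MS.
Proof.
move=> S0 SP.
pose inS (M : 'M[K]_m) := forall v, (v <= M)%MS -> S v.
pose Q r := `[< exists M, inS M /\ \rank M = r >].
have Q0 : exists r, Q r.
  exists 0%N; apply/asboolP; exists 0; split; last by rewrite mxrank0.
  by move=> v; rewrite submx0 => /eqP ->.
have Qm r : Q r -> (r <= m)%N by move=> /asboolP[M [_ <-]]; exact: rank_leq_row.
case: (ex_maxnP Q0 Qm) => r /asboolP[M [SM Mr]] rmax.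
exists M => v; split=> [Sv|]; last exact: SM.
have : (\rank (M + v)%MS <= \rank M)%N.
  rewrite Mr; apply: rmax; apply/asboolP; exists (M + v)%MS; split=> // u.
  case/sub_addsmxP => -[a b] /= ->; rewrite addrC [b]mx11_scalar mul_scalar_mx.
  by apply: SP => //; apply: SM; exact: submxMl.
rewrite (geq_leqif (mxrank_leqif_sup (addsmxSl M v))).
exact: submx_trans (addsmxSr _ _).
Qed.

End Contraction.

(** * Cycles with coefficients in a space of sections *)

Section Evaluation.
Variables (K : fieldType) (m : nat) (U : lmodType K).
Variables (T : Type) (G : T -> lmodType K) (ev : forall x, U -> G x).
Variables (v : T -> 'rV[K]_m) (r : nat).
Hypothesis lin_ev : forall x, linear (@ev x).

(** A bound on dimension that applies to spaces given by predicates, and passes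
    to hyperplanes without any choice of basis. *)
Definition dim_le (V : U -> Prop) (e : nat) :=
  forall s : 'I_e.+1 -> U, (forall i, V (s i)) ->
  exists2 a : 'rV[K]_e.+1, a != 0 & \sum_i a 0 i *: s i = 0.

Lemma ev0 x : ev x 0 = 0.
Proof. by have := lin_ev x (-1) 0 0; rewrite scaler0 addr0 scaleN1r addNr. Qed.

Lemma dim_le_spanned (V : U -> Prop) e (f : 'I_e -> U) :
  (forall s, V s -> exists a : 'rV[K]_e, s = \sum_i a 0 i *: f i) -> dim_le V e.
Proof.
move=> Vf s Vs.
have h i := cid (Vf _ (Vs i)).
pose C : 'M[K]_(e.+1, e) := \matrix_i sval (h i).
have [|a a0 aC] := @lowrank_kernel K _ _ C; first by rewrite ltnS rank_leq_col.
exists a => //.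
transitivity (\sum_k (a *m C) 0 k *: f k); last first.
  by rewrite aC big1 // => k _; rewrite mxE scale0r.
rewrite comb_mulmx; apply: eq_bigr => i _; congr (_ *: _).
by rewrite {1}(svalP (h i)); apply: eq_bigr => k _; rewrite !mxE.
Qed.

(** Dependence relations between s0 and sections that vanish at x do not involve
    s0, as evaluating them at x shows. *)
Lemma dim_le_vanish (V : U -> Prop) e s0 x : V s0 -> ev x s0 <> 0 ->
  dim_le V e.+1 -> dim_le (fun s => V s /\ ev x s = 0) e.
Proof.
move=> Vs0 s0x dV s hs.
pose s' i := if unlift ord0 i is Some j then s j else s0.
have [i|a a0 ha] := dV s'; first by rewrite /s'; case: unlift => [j|//]; case: (hs j).
move: ha; rewrite big_ord_recl /s' unlift_none.
under eq_bigr do rewrite liftK.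
move=> ha; have a00 : a 0 ord0 = 0.
  have := congr1 (@ev x) ha; rewrite lin_ev (linear_comb _ _ _ (@lin_ev x)) ev0 big1 ?addr0.
    by move/eqP; rewrite scaler_eq0 => /orP[/eqP //|/eqP].
  by move=> i _; case: (hs i) => _ ->; rewrite scaler0.
exists (\row_i a 0 (lift ord0 i)).
  apply: contraNneq a0 => b0; apply/eqP/rowP => i; rewrite mxE.
  case: (unliftP ord0 i) => [j ->|->]; last exact: a00.
  by have /rowP/(_ j) := b0; rewrite !mxE.
by move: ha; rewrite a00 scale0r add0r => ha; under eq_bigr do rewrite mxE.
Qed.

(** Here v x stands for the coordinates of ev_x on a basis of W.  The first
    hypothesis says that, for a nonzero section s of V, the functionals ev_x at
    the points where s does not vanish span a space of dimension at least r;
    it is inherited by the subspaces of V, so it survives the induction. *)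
Lemma cycles_eq0 e t (V : U -> Prop) (c : {set 'I_m} -> U) :
  (forall s, V s -> s <> 0 -> forall M : 'M[K]_m,
     (forall x, ev x s <> 0 -> (v x <= M)%MS) -> (r <= \rank M)%N) ->
  V 0 -> (forall a s s', V s -> V s' -> V (a *: s + s')) ->
  dim_le V e -> (m + e <= t + r)%N ->
  (forall A, V (c A)) -> (forall A : {set 'I_m}, #|A| != t -> c A = 0) ->
  (forall x A, ev x (contract (v x) c A) = 0) ->
  forall A : {set 'I_m}, c A = 0.
Proof.
elim: e t V c => [|e IH] t V c gen V0 VP dV tr Vc ct cyc A.
  have [i|a a0] := dV (fun=> c A); first exact: Vc.
  rewrite big_ord1 => /eqP; rewrite scaler_eq0 => /orP[/eqP a00|/eqP //].
  by case/eqP: a0; apply/rowP => i; rewrite ord1 a00 mxE.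
have [//|cA0] := pselect (c A = 0).
case: t => [|t] in tr ct *.
  have : (r <= m)%N.
    rewrite -[m](@mxrank1 K); apply: (gen _ (Vc A) cA0) => x _; exact: submx1.
  by rewrite leqNgt (leq_trans _ tr) // addnS ltnS leq_addr.
have contract0 x : ev x (c A) <> 0 -> forall B, contract (v x) c B = 0.
  move=> cAx; apply: (IH t (fun s => V s /\ ev x s = 0)).
  - by move=> s [Vs _]; exact: gen.
  - by split => //; exact: ev0.
  - by move=> a s s' [Vs sx] [Vs' s'x]; split; [exact: VP|rewrite lin_ev sx s'x scaler0 addr0].
  - exact: dim_le_vanish cAx dV.
  - by move: tr; rewrite addnS addSn ltnS.
  - move=> B; split; last exact: cyc.
    by apply: (big_ind V) => [//|s s' ? ?|i _]; [rewrite -[s]scale1r|rewrite -[_ *: _]addr0]; exact: VP.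
  - by move=> B; exact: contract_deg.
  (* The contraction of c with ev_x is a cycle, because contracting with ev_x
     commutes up to sign with contracting with ev_y. *)
  move=> y B; rewrite contractC -scaleN1r -[_ *: _]addr0 lin_ev ev0 addr0.
  rewrite /contract (linear_comb _ _ _ (@lin_ev y)) big1 ?scaler0 // => i _.
  by rewrite cyc scaler0.
have [||M MP] := @prop_subspace_rowspace K m (fun u => forall B, contract u c B = 0).
- by move=> B; apply: big1 => i _; rewrite mxE mulr0 scale0r.
- by move=> a u u' hu hu' B; rewrite contract_linear hu hu' scaler0 addr0.
apply: (@contract_eq0 _ _ _ M t.+1) => //.
  by move=> u /MP.
apply: (@leq_trans (t.+1 + r)); first by apply: leq_trans tr; rewrite addnS ltnS leq_addr.
rewrite leq_add2l; apply: (gen _ (Vc A) cA0) => x cAx.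
by apply/MP; exact: contract0.
Qed.

End Evaluation.

(** * Irreducible components and nonvanishing sections *)

Local Open Scope classical_set_scope.

Section Components.
Variables (K : closedFieldType) (n : nat).
Local Notation P := (proj K n).
Implicit Types (X Z : set P).

Lemma irreducible_set1 (p : P) : irreducible_set [set p].
Proof.
split; first by exists p.
by move=> F G _ _ /(_ p erefl)[Fp|Gp]; [left|right] => _ ->.
Qed.

Lemma irreducible_meet Z (U V : set P) : irreducible_set Z ->
  zopen U -> zopen V -> Z `&` U !=set0 -> Z `&` V !=set0 ->
  exists2 p, Z p & U p /\ V p.
Proof.
move=> [_ irrZ] oU oV [p [Zp Up]] [q [Zq Vq]]; apply: contrapT => nex.
have [q' Zq'|ZU|ZV] := irrZ _ _ oU oV.
- by apply: contrapT => /not_orP[/contrapT Uq' /contrapT Vq']; apply: nex; exists q'.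
- exact: ZU Up.
- exact: ZV Vq.
Qed.

(** Zorn's lemma, applied to the sets A such that A together with p is
    irreducible: adding p makes the union of the empty chain admissible. *)
Lemma irr_component_cover X (p : P) : X p -> exists2 Z, irr_component X Z & Z p.
Proof.
move=> Xp.
have [F FP Ftot|A [[irrA AX] Amax]] :=
    @Zorn_bigcup _ [set A | irreducible_set (p |` A) /\ A `<=` X].
  split; last by move=> q [B FB Bq]; have [_] := FP _ FB; exact.
  (* With set0 added, each point of p |` \bigcup F lies in p |` B for a member
     B of the chain, even when that point is p and F is empty. *)
  pose F' := set0 |` F.
  have F'P B : F' B -> irreducible_set (p |` B).
    by case=> [->|/FP[]//]; rewrite setU0; exact: irreducible_set1.
  have F'B q : (p |` \bigcup_(B in F) B) q -> exists2 B, F' B & (p |` B) q.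
    case=> [->|[B FB Bq]]; first by exists set0; left.
    by exists B; right.
  have F'tot B C : F' B -> F' C -> B `<=` C \/ C `<=` B.
    case=> [->|FB]; first by left.
    case=> [->|FC]; first by right.
    exact: Ftot.
  split; first by exists p; left.
  move=> G H cG cH GH; apply: contrapT => /not_orP[].
  move=> /existsNP[a /not_implyP[/F'B[B FB Ba] nGa]].
  move=> /existsNP[b /not_implyP[/F'B[C FC Cb] nHb]].
  have [D [FD Da Db]] : exists D, [/\ F' D, (p |` D) a & (p |` D) b].
    by case: (F'tot _ _ FB FC) => h; [exists C|exists B]; split=> //;
      [case: Ba|case: Cb]; (by left) || (by right; exact: h).
  have [_ irrD] := F'P _ FD.
  have DU : p |` D `<=` p |` \bigcup_(B in F) B.
    move=> q [->|Dq]; first by left.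
    by case: FD Dq => [->//|FD Dq]; right; exists D.
  by case: (irrD G H cG cH (subset_trans DU GH)) => [/(_ _ Da)|/(_ _ Db)].
have Ap : A p.
  apply: contrapT => nAp; apply: (Amax (p |` A)).
    by split=> [q Aq|/(_ p)h]; [right|apply: nAp; apply: h; left].
  split; first by rewrite setUA setUid.
  by move=> q [->//|/AX].
have pA : p |` A = A by apply/seteqP; split=> [q [->//|//]|q Aq]; right.
rewrite pA in irrA.
exists A => //; split=> // Y irrY AY YX; apply/seteqP; split=> //.
apply: contrapT => nYA; apply: (Amax Y); first by split.
by split=> //; rewrite (_ : p |` Y = Y) //; apply/seteqP;
  split=> [q [->|//]|q Yq]; [exact: AY|right].
Qed.

Lemma chart_coord_neq0 X (E : vbundle X) (i : chart E) (x : X) (u : E x) :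
  dom i (val x) -> u != 0 -> exists k, triv i x u 0 k != 0.
Proof.
move=> ix u0; apply: contrapT => nex; case/eqP: u0.
apply: (bij_inj (triv_bij ix)); rewrite linear0; apply/rowP => k; rewrite mxE.
by apply: contrapT => /eqP uk; apply: nex; exists k.
Qed.

(** In a chart containing x, some coordinate of s is a quotient a/b near x with
    a(x) nonzero; s does not vanish where a does not. *)
Lemma nonvanishing_open X (E : vbundle X) (s : sec E) (x : X) :
  H0 E s -> s x != 0 ->
  exists U, [/\ zopen U, U (val x) & forall y : X, U (val y) -> s y != 0].
Proof.
move=> hs sx0; have [i ix] := dom_cover E x.
have [k sxk] := chart_coord_neq0 ix sx0.
have [V [d [a [b [oV Vx ha _ hab]]]]] := hs i k x ix.
exists (dom i `&` V `&` [set p | peval a p != 0]); split.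
- apply: zopenI; first by apply: zopenI oV; exact: dom_open.
  exists [set a]; first by move=> _ ->; exists d.
  apply/seteqP; split=> p /=.
    by move=> /negP; rewrite negbK => /eqP ap _ ->.
  by move=> /(_ a erefl) ->; rewrite eqxx.
- split => //=; apply: contraNneq sxk => ax.
  by have [_ ->] := hab x ix Vx; rewrite ax mul0r.
move=> y [[iy Vy] ay]; apply: contraNneq ay => sy.
have [by0] := hab y iy Vy; rewrite sy linear0 mxE => /esym/eqP.
by rewrite mulf_eq0 invr_eq0 (negPf by0) orbF.
Qed.

Lemma common_nonvanishing X (E L : vbundle X) (Z : set P) (ZX : Z `<=` X)
    (s : sec E) (q : sec L) : irreducible_set Z -> H0 E s -> H0 L q ->
  res ZX E s != 0 -> res ZX L q != 0 ->
  exists2 z : Z, res ZX E s z != 0 & res ZX L q z != 0.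
Proof.
have nz (B : vbundle X) (b : sec B) : res ZX B b != 0 ->
    exists z : Z, b (Defs.incl ZX z) != 0.
  move=> b0; apply: contrapT => nex; case/eqP: b0.
  apply: functional_extensionality_dep => z.
  by apply: contrapT => /eqP bz; apply: nex; exists z.
move=> irrZ hs hq /nz[y sy] /nz[y' qy'].
have [U [oU Uy UP]] := nonvanishing_open hs sy.
have [V [oV Vy' VP]] := nonvanishing_open hq qy'.
have [p Zp [Up Vp]] : exists2 p, Z p & U p /\ V p.
  apply: irreducible_meet => //.
    by exists (val y); split => //; exact: set_valP.
  by exists (val y'); split => //; exact: set_valP.
by exists (exist _ p (mem_set Zp)); [exact: UP | exact: VP].
Qed.

Lemma line_bundle_coord X (L : vbundle X) (x : X) : line_bundle L ->
  exists2 l : L x, l != 0 & forall u, exists k, u = k *: l.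
Proof.
move=> /(_ x) dL.
exists (vpick {:L x}); first by rewrite vpick0 -dimv_eq0 dL.
move=> u; apply/vlineP.
have /eqP -> : (<[vpick {:L x}]> == fullv)%VS.
  by rewrite eqEdim subvf dL dim_vline vpick0 -dimv_eq0 dL.
exact: memvf.
Qed.

(** * Koszul cycles on a component *)

(** The tensor product is encoded by homomorphisms out of the dual, so that a
    coordinate functional that is nonzero on l recovers e. *)
Lemma tensor_mul_eq0 X (A L : vbundle X) (x : X) (e : A x) (l : L x) :
  l != 0 -> tensor_mul e l = 0 -> e = 0.
Proof.
move=> l0 el0; have [j jx] := dom_cover L x.
have [k lk] := chart_coord_neq0 jx l0.
pose lam : dual_bundle L x := linfun (fun u : L x => triv j x u 0 k : K^o).
have lamE : (lam : 'Hom(L x, K^o)) l = triv j x l 0 k.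
  by rewrite linfunE // => a u u'; rewrite linearP !mxE.
have := tensor_mulE e l lam; rewrite el0 lamE zero_lfunE => /esym/eqP.
by rewrite scaler_eq0 (negPf lk) => /eqP.
Qed.

Lemma tensor_mulDl X (A L : vbundle X) (x : X) (l : L x) :
  linear (fun e : A x => tensor_mul e l).
Proof.
move=> k u v; apply/lfunP => lam.
by rewrite add_lfunE scale_lfunE !tensor_mulE scalerDr !scalerA mulrC.
Qed.

Lemma tensor_mulZl X (A L : vbundle X) (x : X) (e : A x) (k : K) (l : L x) :
  tensor_mul (k *: e) l = k *: tensor_mul e l.
Proof.
by apply/lfunP => lam; rewrite scale_lfunE !tensor_mulE !scalerA mulrC.
Qed.

Lemma tensor_mulZr X (A L : vbundle X) (x : X) (e : A x) (k : K) (l : L x) :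
  tensor_mul e (k *: l) = tensor_mul (k *: e) l.
Proof.
by apply/lfunP => lam; rewrite !tensor_mulE linearZ /= !scalerA mulrC.
Qed.

(** With l trivializing the fibre of L at x, the functional ev_x has coordinates v,
    and the Koszul differential at x is the contraction with it. *)
Lemma koszul_d_contract X (L E : vbundle X) (m : nat) (w : 'I_m -> sec L)
    (c : {set 'I_m} -> sec E) (x : X) (l : L x) (v : 'rV[K]_m) :
  l != 0 -> (forall i, w i x = v 0 i *: l) ->
  koszul_d w (@tensor_mul K n X E L) c = 0 -> forall A, contract v c A x = 0.
Proof.
move=> l0 wE dc A; apply: (tensor_mul_eq0 l0).
have := congr1 (fun f => f A x) dc; rewrite [RHS](_ : _ = 0) // => <-.
have -> : contract v c A x = \sum_(i in ~: A)
    ((-1) ^+ position A i * v 0 i) *: (c (i |: A) x : E x).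
  by rewrite /contract (linear_comb (f := fun s : sec E => s x)).
rewrite (linear_comb _ _ _ (@tensor_mulDl X E L x l)); apply: eq_bigr => i _.
by rewrite wE tensor_mulZr -scalerA -tensor_mulZl.
Qed.

Lemma is_basis_mem (V : lmodType K) (A : set V) d (b : 'I_d -> V) :
  is_basis A b -> forall k, A (b k).
Proof.
case=> _ -> k; exists (fun i => (i == k)%:R) => //.
rewrite (bigD1 k) //= eqxx scale1r big1 ?addr0 // => i /negPf ->.
by rewrite scale0r.
Qed.

Lemma is_basis_comb (V : lmodType K) (A : set V) d (b : 'I_d -> V) s :
  is_basis A b -> A s -> exists a : 'rV[K]_d, s = \sum_i a 0 i *: b i.
Proof.
case=> _ -> [a _ <-]; exists (\row_i a i).
by apply: eq_bigr => i _; rewrite mxE.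
Qed.

Lemma linear_res X (E : vbundle X) (Z : set P) (ZX : Z `<=` X) : linear (res ZX E).
Proof. by []. Qed.

(** If the functionals ev_x, for x off the zeros of s, spanned a space of rank
    less than r, then they would all kill some q in W that is nonzero on Z.
    But q and s do not vanish at some common point of Z. *)
Lemma evaluation_rank X (L E : vbundle X) (W : set (sec L)) (m r : nat)
    (w : 'I_m -> sec L) (Z : set P) (ZX : Z `<=` X)
    (l : forall z : Z, L (Defs.incl ZX z)) (v : Z -> 'rV[K]_m)
    (s : sec E) (M : 'M[K]_m) :
  irreducible_set Z -> W `<=` H0 L -> is_basis W w ->
  has_dim (res ZX L @` W) r ->
  (forall z i, w i (Defs.incl ZX z) = v z 0 i *: l z) ->
  H0 E s -> res ZX E s != 0 ->
  (forall z : Z, res ZX E s z <> 0 -> (v z <= M)%MS) -> (r <= \rank M)%N.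
Proof.
move=> irrZ hW bw [b bb] wE hs s0 hM; rewrite leqNgt; apply/negP => rM.
have h k : exists u : 'rV[K]_m, b k = res ZX L (\sum_i u 0 i *: w i).
  have [u Wu <-] := is_basis_mem bb k.
  by have [a ->] := is_basis_comb bw Wu; exists a.
have h' k := cid (h k).
pose B : 'M[K]_(r, m) := \matrix_k sval (h' k).
have bE k : b k = res ZX L (\sum_i B k i *: w i).
  by rewrite {1}(svalP (h' k)); congr res; apply: eq_bigr => i _; rewrite mxE.
have [|a a0 aBM] := @lowrank_kernel K r m (B *m M^T).
  by rewrite (leq_ltn_trans _ rM) // -(mxrank_tr M) mxrankM_maxr.
pose q : sec L := \sum_i (a *m B) 0 i *: w i.
have hq : H0 L q.
  by apply: H0_sum => i _; apply: H0_Z; apply: hW; exact: is_basis_mem bw i.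
have q0 : res ZX L q != 0.
  apply: contraNneq a0 => q0; apply/eqP/rowP => k; rewrite mxE.
  case: bb => bfree _; apply: (bfree (fun k => a 0 k)).
  rewrite -[RHS]q0 /q comb_mulmx (linear_comb _ _ _ (@linear_res X L Z ZX)).
  by apply: eq_bigr => i _; rewrite bE.
have [x sx /eqP qx] := common_nonvanishing irrZ hs hq s0 q0.
have /submxP[D vD] := hM _ (elimN eqP sx).
apply: qx; rewrite /res.
have -> : q (Defs.incl ZX x) = ((a *m B) *m (v x)^T) 0 0 *: l x.
  rewrite mxE scaler_suml /q (linear_comb (f := fun p : sec L => p _)) //.
  by apply: eq_bigr => i _; rewrite wE scalerA [_^T _ _]mxE.
by rewrite vD trmx_mul mulmxA -(mulmxA a) aBM mul0mx mxE scale0r.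
Qed.

(** A nonzero vector l z is chosen in each fibre of L, with no regularity in z:
    being a cycle, and the span of the functionals ev_z, depend on each ev_z only
    up to a nonzero scalar. *)
Lemma component_cycles_eq0 X (L E : vbundle X) (W : set (sec L)) (m : nat)
    (w : 'I_m -> sec L) (Z : set P) (ZX : Z `<=` X) (r e t : nat)
    (c : {set 'I_m} -> sec E) :
  irreducible_set Z -> line_bundle L -> W `<=` H0 L -> is_basis W w ->
  has_dim (res ZX L @` W) r -> has_dim (res ZX E @` H0 E) e ->
  (m + e <= t + r)%N ->
  (forall A, H0 E (c A)) -> (forall A : {set 'I_m}, #|A| != t -> c A = 0) ->
  koszul_d w (@tensor_mul K n X E L) c = 0 ->
  forall (A : {set 'I_m}) (z : Z), c A (Defs.incl ZX z) = 0.
Proof.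
move=> irrZ hL hW bw dW [f bf] tr hc ct dc A z.
have [l l0 lP] : exists2 l : forall z : Z, L (Defs.incl ZX z),
    forall z, l z != 0 & forall z u, exists k, u = k *: l z.
  have h (y : Z) : exists l : L (Defs.incl ZX y), l != 0 /\ forall u, exists k, u = k *: l.
    by have [l ? ?] := line_bundle_coord (Defs.incl ZX y) hL; exists l.
  have h' y := cid (h y).
  by exists (fun y => sval (h' y)) => y; case: (svalP (h' y)).
have [v wE] : exists v : Z -> 'rV[K]_m,
    forall z i, w i (Defs.incl ZX z) = v z 0 i *: l z.
  have h' y i := cid (lP y (w i (Defs.incl ZX y))).
  by exists (fun y => \row_i sval (h' y i)) => y i; rewrite mxE; exact: (svalP (h' y i)).
pose U : lmodType K := sec (Defs.restrict ZX E).
pose ev (y : Z) (s : U) : E (Defs.incl ZX y) := s y.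
have lin_ev y : linear (ev y) by [].
have : forall A, (res ZX E (c A) : U) = 0; last by move=> /(_ A) /(congr1 (fun s => s z)).
apply: (@cycles_eq0 K m U Z _ ev v r lin_ev e t (res ZX E @` H0 E)) => //.
- by move=> _ [s hs <-] /eqP s0 M; exact: evaluation_rank bw dW wE hs s0.
- by exists 0 => //; exact: H0_0.
- move=> a _ _ [s hs <-] [s' hs' <-]; exists (a *: s + s') => //.
  by apply: H0_D => //; exact: H0_Z.
- by apply: (@dim_le_spanned _ _ _ _ f) => s; exact: is_basis_comb bf.
- by move=> B; exists (c B).
- by move=> B Bt; rewrite ct.
move=> x B; rewrite -(koszul_d_contract (l0 x) (wE x) dc B) /contract.
rewrite (linear_comb _ _ _ (lin_ev x)).
by rewrite (linear_comb (f := fun s : sec E => s (Defs.incl ZX x))).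
Qed.

End Components.

Theorem theorem5 (R : realType) (n : nat) (X : set (proj R[i] n))
    (hX : projective_curve X) (hlci : deeply_lci X)
    (L : vbundle X) (hL : line_bundle L)
    (W : set (sec L)) (hW : W `<=` H0 L)
    (m : nat) (w : 'I_m -> sec L) (hw : is_basis W w)
    (E : vbundle X)
    (mZ eZ : set (proj R[i] n) -> nat)
    (hmZ : forall (Z : set (proj R[i] n)) (ZX : Z `<=` X),
       irr_component X Z -> has_dim (res ZX L @` W) (mZ Z))
    (heZ : forall (Z : set (proj R[i] n)) (ZX : Z `<=` X),
       irr_component X Z -> has_dim (res ZX E @` H0 E) (eZ Z))
    (t : int)
    (ht : forall Z : set (proj R[i] n), irr_component X Z ->
       (eZ Z)%:Z - (mZ Z)%:Z + m%:Z <= t) :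
  koszul_vanishing w E t.
Proof.
apply/seteqP; split; last first.
  apply: koszul_complex => // i; apply: hW; exact: is_basis_mem hw i.
move=> c [hc dc].
have -> : c = 0.
  apply/funext => A; apply: functional_extensionality_dep => x.
  have [tA|tA] := eqVneq #|A|%:Z t; last by have [_ ->] := hc A.
  have [Z compZ Zx] := irr_component_cover (set_valP x).
  have [irrZ ZX _] := compZ.
  pose z : Z := exist _ (val x) (mem_set Zx).
  have <- : Defs.incl ZX z = x by exact: val_inj.
  apply: (component_cycles_eq0 (t := #|A|) irrZ hL hW hw (hmZ Z ZX compZ) (heZ Z ZX compZ)) => //.
  - have := ht Z compZ; rewrite -tA addrAC lerBlDr -!PoszD lez_nat.
    by rewrite addnC.
  - by move=> B; case: (hc B).
  - by move=> B BA; have [_ ->] := hc B => //; rewrite -tA.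
exists 0; first by move=> B; split=> //; exact: H0_0.
apply/funext => A; apply: functional_extensionality_dep => x.
rewrite [RHS](_ : _ = 0) // /koszul_d big1 // => i _.
by rewrite [tensor_contr _ _](_ : _ = 0) ?scaler0 //; exact: zero_lfunE.
Qed.
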